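(* Let $\tau$ be a face of the positive cone in $\mathbb R^n$ of dimension $t$ with $0<t\le n-1$, let $1\le p,q<\infty$, and equip $\mathbb R^n$ and $\mathbb R^{n-t}\cong\mathbb R^n/\mathbb R\tau$ with Lebesgue measure. Let $M$ be a cubically encoded persistence module over $\mathbb R^n$. If $\|M\|_p<\infty$, then $\|M/\tau\|_q=0$.
   Context: Persistence modules are functors from $\mathbb R^n$ (product order) to finite-dimensional vector spaces over a field. $M$ is cubically encoded if $M\cong M'\circ e$ for an order-preserving map $e\colon\mathbb R^n\to\mathcal P$ to a finite poset whose fibers are finite unions of cubes (products of intervals of $\mathbb R$). A face of the positive cone is $\tau=\{\sum_i a_ie_{j_i}: a_i\ge0\}$ for a set of standard basis vectors $e_{j_1},\dots,e_{j_t}$; $\mathbb R^n/\mathbb R\tau$ is identified with $\mathbb R^{n-t}$ via the remaining coordinates. The quotient restriction $M/\tau$ is the $\mathbb R^n/\mathbb R\tau$-module with $(M/\tau)_{w+\mathbb R\tau}=\varinjlim_{u\in w+\tau}M_u$, with induced structure maps. The $L^p$-Hilbert amplitude is $\|M\|_p=(\int\dim M(x)^p\,d\lambda(x))^{1/p}$, $\lambda$ Lebesgue measure. *)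

(* Defs.v *)
From HB Require Import structures.
From mathcomp Require Import all_boot all_order all_algebra.
From mathcomp Require Import all_classical all_reals all_analysis.
Set Implicit Arguments. Unset Strict Implicit. Unset Printing Implicit Defensive.
Import Order.TTheory GRing.Theory Num.Theory.
Import numFieldNormedType.Exports.
Local Open Scope classical_set_scope.
Local Open Scope ring_scope.

Section prodsf.
Local Open Scope ereal_scope.
Context d1 d2 (T1 : measurableType d1) (T2 : measurableType d2) (R : realType).
Variable m1 : {sigma_finite_measure set T1 -> \bar R}.
Variable m2 : {sigma_finite_measure set T2 -> \bar R}.

(** the product measure [m1 \x m2], repackaged so that its sigma-finiteness
    can be declared canonically *)
Definition prodsf : set (T1 * T2)%type -> \bar R := m1 \x m2.
HB.instance Definition _ := Measure.on prodsf.

Lemma prodsf_sigma_finite : sigma_finite setT prodsf.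
Proof.
have /sigma_finiteP[F [TF ndF Foo]] := sigma_finiteT m1.
have /sigma_finiteP[G [TG ndG Goo]] := sigma_finiteT m2.
exists (fun n => F n `*` G n).
 rewrite -setXTT TF TG predeqE => -[x y]; split.
    move=> [/= [n _ Fnx] [k _ Gky]]; exists (maxn n k) => //; split.
    - by move: x Fnx; exact/subsetPset/ndF/leq_maxl.
    - by move: y Gky; exact/subsetPset/ndG/leq_maxr.
  by move=> [n _ []/= ? ?]; split; exists n.
move=> k; have [? ?] := Foo k; have [? ?] := Goo k.
split; first exact: measurableX.
by rewrite /prodsf product_measure1E// lte_mul_pinfty// ge0_fin_numE.
Qed.

HB.instance Definition _ := Measure_isSigmaFinite.Build _ _ _ prodsf
  prodsf_sigma_finite.
End prodsf.

Record mspace (R : realType) := MSpace {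
  ms_disp : measure_display;
  ms_type : measurableType ms_disp;
  ms_meas : {sigma_finite_measure set ms_type -> \bar R} }.

Fixpoint lebn (R : realType) (n : nat) : mspace R :=
  match n with
  | 0 => @MSpace R _ unit (@dirac _ unit tt R)
  | m.+1 => @MSpace R _ _ (prodsf (@lebesgue_measure R) (ms_meas (lebn R m)))
  end.

Fixpoint coord (R : realType) (n : nat) : ms_type (lebn R n) -> 'I_n -> R :=
  match n return ms_type (lebn R n) -> 'I_n -> R with
  | 0 => fun _ _ => 0
  | m.+1 => fun y i =>
      if unlift ord0 i is Some j then coord y.2 j else y.1
  end.

Definition pleq (R : realType) (n : nat) (x y : 'I_n -> R) : Prop :=
  forall i, x i <= y i.

(** A functor from a poset (P, le) to finite-dimensional k-vector spaces:
    the vector space at x is the row space k^(pdim x), the structure map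
    for x <= y is the matrix [pmap h] acting on row vectors (v |-> v *m A). *)
Record pmod (k : fieldType) (P : Type) (le : P -> P -> Prop) := PMod {
  pdim : P -> nat;
  pmap : forall x y, le x y -> 'M[k]_(pdim x, pdim y);
  pmap_id : forall x (h : le x x), pmap h = 1%:M;
  pmap_comp : forall x y z (hxy : le x y) (hyz : le y z) (hxz : le x z),
      pmap hxz = pmap hxy *m pmap hyz }.
Arguments pdim {k P le}.
Arguments pmap {k P le} _ {x y}.

Definition pmod_iso (k : fieldType) (P : Type) (le : P -> P -> Prop)
    (M N : pmod k le) : Prop :=
  exists (phi : forall x, 'M[k]_(pdim M x, pdim N x))
         (psi : forall x, 'M[k]_(pdim N x, pdim M x)),
    (forall x, phi x *m psi x = 1%:M /\ psi x *m phi x = 1%:M) /\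
    (forall x y (h : le x y), pmap M h *m phi y = phi x *m pmap N h).

Section pullback.
Variables (k : fieldType) (Q P : Type) (leQ : Q -> Q -> Prop) (leP : P -> P -> Prop).
Variables (N : pmod k leP) (e : Q -> P) (mono : forall x y, leQ x y -> leP (e x) (e y)).
Definition pullback : pmod k leQ.
Proof.
refine (@PMod k Q leQ (fun x => pdim N (e x)) (fun x y h => pmap N (mono h)) _ _).
- by move=> x h; exact: pmap_id.
- by move=> x y z hxy hyz hxz; exact: pmap_comp.
Defined.
End pullback.

Definition cube (R : realType) (n : nat) (I : 'I_n -> interval R) : set ('I_n -> R) :=
  [set x | forall i, x i \in I i].

Definition fin_union_cubes (R : realType) (n : nat) (A : set ('I_n -> R)) : Prop :=
  exists (m : nat) (C : 'I_m -> 'I_n -> interval R),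
    A = [set x | exists j, cube (C j) x].

Definition cubically_encoded (k : fieldType) (R : realType) (n : nat)
    (M : pmod k (@pleq R n)) : Prop :=
  exists (d : Order.disp_t) (P : finPOrderType d) (e : ('I_n -> R) -> P)
         (mono : forall x y, pleq x y -> is_true (e x <= e y)%O)
         (N : pmod k (fun a b : P => is_true (a <= b)%O)),
    (forall p : P, fin_union_cubes (e @^-1` [set p])) /\
    pmod_iso M (pullback N mono).

Definition face (R : realType) (n : nat) (S : {set 'I_n}) : set ('I_n -> R) :=
  [set v | forall j, if j \in S then 0 <= v j else v j == 0].

Definition coset_face (R : realType) (n : nat) (S : {set 'I_n}) (x : 'I_n -> R) :
  set ('I_n -> R) := [set u | face S (fun j => u j - x j)].

(** dimension of the colimit  lim_{u in x + tau} M_u  (in \bar R, +oo if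
    infinite-dimensional): supremum of the sizes of the linearly independent
    finite families of elements of the colimit.  An element of the (directed)
    colimit is represented by a pair (u, a) with u in x + tau and a in M_u;
    a linear combination sum_i c_i [a_i] vanishes in the colimit iff
    sum_i c_i (M(u_i <= v) a_i) = 0 for some v in x + tau above all u_i. *)
Definition colim_indep (k : fieldType) (R : realType) (n : nat)
    (M : pmod k (@pleq R n)) (S : {set 'I_n}) (x : 'I_n -> R) (m : nat)
    (u : 'I_m -> 'I_n -> R) (a : forall i, 'rV[k]_(pdim M (u i))) : Prop :=
  forall c : 'I_m -> k,
    (exists (v : 'I_n -> R) (h : forall i, pleq (u i) v),
        coset_face S x v /\ \sum_i c i *: (a i *m pmap M (h i)) = 0) ->
    forall i, c i = 0.

Definition colim_dim (k : fieldType) (R : realType) (n : nat)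
    (M : pmod k (@pleq R n)) (S : {set 'I_n}) (x : 'I_n -> R) : \bar R :=
  ereal_sup [set ((m%:R : R)%:E) | m in
    [set m : nat | exists (u : 'I_m -> 'I_n -> R)
                          (a : forall i, 'rV[k]_(pdim M (u i))),
        (forall i, coset_face S x (u i)) /\ @colim_indep k R n M S x m u a]].

(** identification R^n / R tau = R^(n - t) via the coordinates outside S:
    w : 'I_#|~: S| -> R is sent to the representative with zeros on S *)
Definition lift_quot (R : realType) (n : nat) (S : {set 'I_n})
    (w : 'I_#|~: S| -> R) : 'I_n -> R :=
  fun j => (if j \in ~: S as b return (j \in ~: S) = b -> R
            then fun h => w (enum_rank_in h j) else fun _ => 0) (erefl _).

Definition quot_dim (k : fieldType) (R : realType) (n : nat)
    (M : pmod k (@pleq R n)) (S : {set 'I_n}) (w : 'I_#|~: S| -> R) : \bar R :=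
  @colim_dim k R n M S (lift_quot w).

Definition amplitude (k : fieldType) (R : realType) (n : nat)
    (M : pmod k (@pleq R n)) (p : R) : \bar R :=
  Lnorm (ms_meas (lebn R n)) p%:E (fun y => ((pdim M (coord y))%:R : R)%:E).

Definition quot_amplitude (k : fieldType) (R : realType) (n : nat)
    (M : pmod k (@pleq R n)) (S : {set 'I_n}) (q : R) : \bar R :=
  Lnorm (ms_meas (lebn R #|~: S|)) q%:E (fun y => @quot_dim k R n M S (coord y)).

(* Main.v *)
Require Import Defs.
From HB Require Import structures.
From mathcomp Require Import all_boot all_order all_algebra.
From mathcomp Require Import all_classical all_reals all_analysis.
Import Order.TTheory GRing.Theory Num.Theory.
Set Implicit Arguments. Unset Strict Implicit. Unset Printing Implicit Defensive.
Local Open Scope ring_scope.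
Local Open Scope classical_set_scope.

(* Refining the encoding, R^n is covered by finitely many cubes on each of
   which dim M is constant.  If the stalk of M/tau at w is nonzero, then, the
   colimit being directed, M_v <> 0 at points v of w + tau whose
   tau-coordinates exceed every finite right endpoint of the cover, and the
   cube containing such a v is unbounded in every tau-direction.  If its other
   sides all have positive length, this cube has infinite volume while
   dim M >= 1 on it, contradicting ||M||_p < oo.  Otherwise w lies in a
   degenerate side of one of finitely many cubes, a null subset of R^(n-t). *)

Section nonneg_integral.
Local Open Scope ereal_scope.
Context d (T : measurableType d) (R : realType) (mu : {measure set T -> \bar R}).

(* No measurability needed: the integral of a nonnegative function is the
   supremum over its simple minorants. *)
Lemma ge0_le_integralT (f g : T -> \bar R) :
  (forall x, 0 <= f x) -> (forall x, f x <= g x) ->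
  \int[mu]_x f x <= \int[mu]_x g x.
Proof.
move=> f0 fg; have g0 x : 0 <= g x := le_trans (f0 x) (fg x).
rewrite !ge0_integralTE //; apply: ereal_sup_le => _ [h /= hf <-].
by exists h => //= x; exact: le_trans (hf x) (fg x).
Qed.

Lemma ge0_integral_negligible_eq0 (f : T -> \bar R) (N : set T) :
  mu.-negligible N -> (forall x, 0 <= f x) -> (forall x, ~ N x -> f x = 0) ->
  \int[mu]_x f x = 0.
Proof.
move=> [N0 [mN0 muN0 NN0]] f0 fN; apply/le_anti; rewrite integral_ge0 // andbT.
have -> : 0 = \int[mu]_(x in N0) `|(cst +oo) x|.
  by apply/esym/integral_abs_eq0 => //; exact: measurable_cst.
rewrite [leRHS]integral_mkcond; apply: ge0_le_integralT => // x; rewrite /patch.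
case: ifPn => [_|]; first by rewrite leey.
by rewrite notin_setE => N0x; rewrite fN // => /NN0.
Qed.

Lemma Lnorm_negligible_eq0 (f : T -> \bar R) (q : R) (N : set T) :
  (0 < q)%R -> mu.-negligible N -> (forall x, ~ N x -> f x = 0) ->
  Lnorm mu q%:E f = 0.
Proof.
move=> q0 negN fN; rewrite unlock (ge0_integral_negligible_eq0 negN).
- by rewrite poweR0r // invr_neq0 // gt_eqF.
- by move=> x; exact: poweR_ge0.
- by move=> x Nx; rewrite fN // abse0 poweR0r // gt_eqF.
Qed.

Lemma Lnorm_lty_measure_lty (f : T -> R) (p : R) (A : set T) :
  (0 < p)%R -> measurable A -> (forall x, A x -> 1 <= `|f x|)%R ->
  Lnorm mu p%:E (EFin \o f) < +oo -> mu A < +oo.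
Proof.
move=> p0 mA f1; rewrite unlock => Nlty.
have : \int[mu]_x (`|(f x)%:E| `^ p) < +oo.
  by rewrite ltey; apply: contraTneq Nlty => ->; rewrite poweRyr ?invr_neq0 ?gt_eqF.
apply: le_lt_trans.
have -> : mu A = \int[mu]_x (\1_A x)%:E by rewrite integral_indic // setIT.
apply: ge0_le_integralT => x; first by rewrite lee_fin.
rewrite /indic; case: (boolP (x \in A)) => [/set_mem Ax|_]; last exact: poweR_ge0.
rewrite /= lee_fin; have := ge0_ler_powR (ltW p0) _ _ (f1 x Ax).
by rewrite powR1 nnegrE; apply.
Qed.

End nonneg_integral.

Section lebn_box.
Variable R : realType.

Definition box (m : nat) (I : 'I_m -> interval R) : set (ms_type (lebn R m)) :=
  [set y | cube I (Defs.coord y)].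

Lemma lebn_box (m : nat) (I : 'I_m -> interval R) :
  measurable (box I) /\
  ms_meas (lebn R m) (box I) = (\prod_(i < m) lebesgue_measure [set` I i])%E.
Proof.
elim: m I => [|m IHm] I.
  have -> : box I = setT by apply/seteqP; split => // y _ [].
  by rewrite big_ord0 /= diracE in_setT.
have -> : box I = [set` I ord0] `*` box (I \o lift ord0).
  apply/seteqP; split => [[y1 y2] Iy|[y1 y2] [/= Iy1 Iy2] i].
    split; first by have := Iy ord0; rewrite /= unlift_none.
    by move=> j; have := Iy (lift ord0 j); rewrite /= liftK.
  by rewrite /=; case: unliftP => [j ->|->] //; exact: Iy2.
have [mB BE] := IHm (I \o lift ord0).
split; first exact: measurableX (measurable_itv _) mB.
by rewrite big_ord_recl -BE /= /prodsf product_measure1E //; exact: measurable_itv.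
Qed.

Lemma lebn_coord_negligible (m : nat) (l : 'I_m) (J : interval R) :
  lebesgue_measure [set` J] = 0%E ->
  (ms_meas (lebn R m)).-negligible [set y | Defs.coord y l \in J].
Proof.
move=> J0; pose I i := if i == l then J else `]-oo, +oo[%O.
have [mB BE] := lebn_box I.
exists (box I); split => //.
  by rewrite BE (bigD1 l) //= /I eqxx J0 mul0e.
by move=> y /= Jy i; rewrite /I; case: eqP => [->|_] //; rewrite in_itv.
Qed.

End lebn_box.

Lemma prode_eq_pinfty (R : realDomainType) (I : finType) (F : I -> \bar R) (i0 : I) :
  F i0 = +oo%E -> (forall i, 0 < F i)%E -> (\prod_i F i = +oo)%E.
Proof.
move=> Fi0 F_gt0; rewrite (bigD1 i0) //= Fi0 gt0_mulye //.
by elim/big_ind: _ => [|x y|i _]; [exact: lte01|exact: mule_gt0|exact: F_gt0].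
Qed.

Lemma negligible_big_setU d (T : ringOfSetsType d) (R : realFieldType)
    (mu : {content set T -> \bar R}) (I : finType) (P : pred I) (F : I -> set T) :
  (forall i, P i -> mu.-negligible (F i)) ->
  mu.-negligible (\big[setU/set0]_(i | P i) F i).
Proof.
by move=> negF; elim/big_ind: _ => //; [exact: negligible_set0|exact: negligibleU].
Qed.

Definition itv_rbound (R : realType) (I : interval R) : R :=
  if I.2 is BSide _ y then y else 0.

Lemma lebesgue_measure_itv_pinfty (R : realType) (I : interval R) (r : R) :
  r \in I -> itv_rbound I < r -> lebesgue_measure [set` I] = +oo%E.
Proof.
case: I => l [b y|[]]; rewrite /itv_rbound /=.
- by rewrite in_itv /= => /andP[_ /lteifW ry] /(le_lt_trans ry); rewrite ltxx.
- by rewrite in_itv /= andbF.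
- move=> rI _; rewrite lebesgue_measure_itv /=.
  by case: l rI => [a x|[]]; rewrite ?in_itv //= ?ltry ?andbT.
Qed.

Lemma pmod_iso_dim (k : fieldType) (P : Type) (le : P -> P -> Prop) (M N : pmod k le) :
  pmod_iso M N -> forall x, pdim M x = pdim N x.
Proof.
move=> [phi [psi [inv _]]] x; have [phipsi psiphi] := inv x.
apply/eqP; rewrite eqn_leq; apply/andP; split.
  by rewrite -[leqLHS](mxrank1 k) -phipsi (leq_trans (mxrankM_maxl _ _)) ?rank_leq_col.
by rewrite -[leqLHS](mxrank1 k) -psiphi (leq_trans (mxrankM_maxl _ _)) ?rank_leq_col.
Qed.

Lemma cubically_encoded_cover (k : fieldType) (R : realType) (n : nat)
    (M : pmod k (@pleq R n)) :
  cubically_encoded M ->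
  exists (I : finType) (C : I -> 'I_n -> interval R),
    (forall x, exists i, cube (C i) x) /\
    (forall i x y, cube (C i) x -> cube (C i) y -> pdim M x = pdim M y).
Proof.
move=> [d [P [e [mono [N [fib iso]]]]]].
have /choice[mC fibE] : forall p : P,
    exists mC : {m : nat & 'I_m -> 'I_n -> interval R},
      e @^-1` [set p] = [set x | exists j, cube (projT2 mC j) x].
  by move=> p; have [m [C ->]] := fib p; exists (existT _ m C).
have fibP p j x : cube (projT2 (mC p) j) x -> e x = p.
  by move=> Cx; have : (e @^-1` [set p]) x by rewrite fibE; exists j.
exists {p : P & 'I_(projT1 (mC p))}, (fun i => projT2 (mC (projT1 i)) (projT2 i)).
split=> [x|[p j] x y /= /fibP ex /fibP ey].
  have : (e @^-1` [set e x]) x by [].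
  by rewrite fibE => -[j Cx]; exists (existT _ (e x) j).
by rewrite !(pmod_iso_dim iso) /= ex ey.
Qed.

Section lift_quot.
Variables (R : realType) (n : nat) (S : {set 'I_n}) (w : 'I_#|~: S| -> R).

Lemma lift_quot_notin j (h : j \in ~: S) : lift_quot w j = w (enum_rank_in h j).
Proof.
rewrite /lift_quot; move: (erefl (j \in ~: S)); rewrite {2 3}h => e.
by rewrite (bool_irrelevance e h).
Qed.

Lemma lift_quot_enum_val (l : 'I_#|~: S|) : lift_quot w (enum_val l) = w l.
Proof. by rewrite (lift_quot_notin (enum_valP l)) enum_valK_in. Qed.

End lift_quot.

Lemma coset_faceP (R : realType) (n : nat) (S : {set 'I_n}) (x v : 'I_n -> R) :
  coset_face S x v <-> forall j, if j \in S then (x j <= v j : Prop) else v j = x j.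
Proof.
split=> xv j; move: (xv j); rewrite /=; case: (j \in S); rewrite ?subr_ge0 //.
  by rewrite subr_eq0 => /eqP.
by move=> ->; rewrite subrr.
Qed.

Lemma colim_dim_eq0 (k : fieldType) (R : realType) (n : nat) (M : pmod k (@pleq R n))
    (S : {set 'I_n}) (x : 'I_n -> R) (B : R) :
  (forall v, coset_face S x v -> (forall s, s \in S -> B < v s) -> pdim M v = 0%N) ->
  colim_dim M S x = 0%E.
Proof.
move=> far0; apply/le_anti/andP; split; last first.
  apply: ereal_sup_ubound; exists 0%N => //.
  by exists (fun _ => x), (fun _ => 0); split=> [|c _]; case.
rewrite /colim_dim; apply: ge_ereal_sup => _ [[|m] [u [a [ux ind]]] <-] //=.
pose v j := if j \in S then \big[Order.max/B + 1]_(l < m.+1) u l j else x j.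
have uv l : pleq (u l) v.
  move=> j; rewrite /v; case: ifPn => jS; first exact: (le_bigmax _ _ l).
  by have /coset_faceP/(_ j) := ux l; rewrite (negbTE jS) => ->.
have vx : coset_face S x v.
  apply/coset_faceP => j; rewrite /v; case: (boolP (j \in S)) => // jS.
  have /coset_faceP/(_ j) := ux ord0; rewrite jS => /le_trans; apply.
  exact: (le_bigmax _ _ ord0).
have dimv0 : pdim M v = 0%N.
  apply: (far0 _ vx) => s sS; rewrite /v sS.
  by apply: lt_le_trans (bigmax_ge_id _ _ _ _); rewrite ltrDl.
have sum0 : \sum_l (1 : k) *: (a l *m Defs.pmap M (uv l)) = 0.
  by move: (\sum_l _); rewrite dimv0 => A; rewrite thinmx0.
have /eqP := ind (fun=> 1) (ex_intro _ v (ex_intro _ uv (conj vx sum0))) ord0.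
by rewrite oner_eq0.
Qed.

Section cube_cover.
Variables (k : fieldType) (R : realType) (n : nat) (M : pmod k (@pleq R n)).
Variables (S : {set 'I_n}) (I : finType) (C : I -> 'I_n -> interval R).
Hypothesis C_cover : forall x, exists i, cube (C i) x.
Hypothesis C_dim : forall i x y, cube (C i) x -> cube (C i) y -> pdim M x = pdim M y.

Definition degenerate_slabs : set (ms_type (lebn R #|~: S|)) :=
  \big[setU/set0]_(il : I * 'I_#|~: S| |
                   lebesgue_measure [set` C il.1 (enum_val il.2)] == 0%E)
    [set y | Defs.coord y il.2 \in C il.1 (enum_val il.2)].

Lemma degenerate_slabs_negligible :
  (ms_meas (lebn R #|~: S|)).-negligible degenerate_slabs.
Proof. by apply: negligible_big_setU => il /eqP; exact: lebn_coord_negligible. Qed.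

Lemma quot_dim_eq0 (p : R) (y : ms_type (lebn R #|~: S|)) :
  0 < p -> (amplitude M p < +oo)%E -> (0 < #|S|)%N -> ~ degenerate_slabs y ->
  @quot_dim k R n M S (Defs.coord y) = 0%E.
Proof.
move=> p_gt0 Mp /card_gt0P[s0 s0S] y_slabs.
pose B := \big[Order.max/0]_(js : I * 'I_n) itv_rbound (C js.1 js.2).
apply: (colim_dim_eq0 (B := B)) => v /coset_faceP vy vB.
apply/eqP; apply: contraT => dimv; have [i Civ] := C_cover v.
have Ci_S s : s \in S -> lebesgue_measure [set` C i s] = +oo%E.
  move=> sS; apply: (lebesgue_measure_itv_pinfty (Civ s)).
  exact: le_lt_trans (le_bigmax _ _ (i, s)) (vB s sS).
have Ci_notS (l : 'I_#|~: S|) : (0 < lebesgue_measure [set` C i (enum_val l)])%E.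
  rewrite lt0e measure_ge0 andbT; apply/negP => /eqP Ci0; apply: y_slabs.
  rewrite /degenerate_slabs (bigD1 (i, l)) /=; last by rewrite Ci0.
  left; have := vy (enum_val l); have := enum_valP l; rewrite inE => /negbTE ->.
  by rewrite lift_quot_enum_val => <-; exact: Civ.
have box_inf : ms_meas (lebn R n) (box (C i)) = +oo%E.
  rewrite (lebn_box (C i)).2 (prode_eq_pinfty (Ci_S s0 s0S)) // => j.
  case: (boolP (j \in S)) => [/Ci_S ->//|jS].
  have jS' : j \in ~: S by rewrite inE.
  by rewrite -(enum_rankK_in jS' jS'); exact: Ci_notS.
suff : (ms_meas (lebn R n) (box (C i)) < +oo)%E by rewrite box_inf ltxx.
apply: (Lnorm_lty_measure_lty (f := fun y => (pdim M (Defs.coord y))%:R) p_gt0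
  (lebn_box (C i)).1 _ Mp) => x Cx.
by rewrite (C_dim Cx Civ) normr_nat ler1n lt0n.
Qed.

End cube_cover.

Theorem mainTheorem16 (k : fieldType) (R : realType) (n t : nat)
    (S : {set 'I_n}) (p q : R) (M : pmod k (@pleq R n)) :
  #|S| = t -> (0 < t)%N -> (t <= n - 1)%N ->
  1 <= p -> 1 <= q ->
  cubically_encoded M ->
  (amplitude M p < +oo)%E ->
  quot_amplitude M S q = 0%E.
Proof.
move=> St t_gt0 _ p_ge1 q_ge1 /cubically_encoded_cover[I [C [C_cover C_dim]]] Mp.
have p_gt0 : 0 < p := lt_le_trans ltr01 p_ge1.
have S_gt0 : (0 < #|S|)%N by rewrite St.
apply: (Lnorm_negligible_eq0 _ (degenerate_slabs_negligible S C)) => [|y].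
  exact: lt_le_trans ltr01 q_ge1.
exact: (quot_dim_eq0 (y := y) C_cover C_dim p_gt0 Mp S_gt0).
Qed.
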